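(* Let $d\ge 2$, $I=\{1,\dots,d-1\}$, $n_1,\dots,n_{d-1}\in\mathbb N$, and let $\mathcal K\subset\{J\mid \emptyset\neq J\subset I\}$ be a family of subsets. For each $J\in\mathcal K$ let $\sigma^{(J)}\in\mathcal D^\infty_{\ge 0}$, and let $(\sigma^{(J)})^2$ denote the entrywise square. Then the collection $\{(\sigma^{(J)})^2\}_{J\in\mathcal K}$ is compatible for $(n_1,\dots,n_{d-1})$ if and only if there is some $n_d\in\mathbb N$ such that the collection $\{\sigma^{(J)}\}_{J\in\mathcal K}$ is feasible for $(n_1,\dots,n_{d-1},n_d)$. Moreover, if $\rho_I$ is a matrix realizing the compatibility of $\{(\sigma^{(J)})^2\}_{J\in\mathcal K}$, then any $n_d\in\mathbb N$ with $n_d\ge \operatorname{rank}(\rho_I)$ suffices.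
   Context: $\mathbb N=\{1,2,\dots\}$. $\mathcal D^\infty_{\ge 0}$ is the set of weakly decreasing sequences of non-negative real numbers with finitely many nonzero entries. Tuples of eigenvalues ($\mathrm{eig}$, of Hermitian positive semi-definite matrices) and of singular values ($\mathrm{sv}$) are sorted in weakly decreasing order (with multiplicity) and extended by zeros to elements of $\mathcal D^\infty_{\ge0}$. For $J\subset I$ put $n_J=\prod_{i\in J}n_i$. The partial trace $\mathrm{trace}_{I\setminus J}:\mathbb C^{n_I\times n_I}\to\mathbb C^{n_J\times n_J}$ is the linear map induced by $\mathrm{trace}_{I\setminus J}(A_1\otimes\dots\otimes A_{d-1})=\prod_{i\notin J}\mathrm{trace}(A_i)\cdot\bigotimes_{i\in J}A_i$ for $A_i\in\mathbb C^{n_i\times n_i}$. Compatible (quantum marginal problem): a collection $\{\lambda^{(J)}\}_{J\in\mathcal K}$ with $\lambda^{(J)}\in\mathcal D^\infty_{\ge0}$ is compatible for $(n_1,\dots,n_{d-1})$ if there is a Hermitian positive semi-definite matrix $\rho_I\in\mathbb C^{n_I\times n_I}$ such that $\mathrm{eig}(\mathrm{trace}_{I\setminus J}(\rho_I))=\lambda^{(J)}$ for all $J\in\mathcal K$; such a $\rho_I$ is said to realize the compatibility. Feasible (tensor feasibility problem over $\mathbb C$): a collection $\{\sigma^{(J)}\}_{J\in\mathcal K}$ is feasible for $(n_1,\dots,n_d)$ if there is a tensor $A\in\mathbb C^{n_1\times\dots\times n_d}$ with $\mathrm{sv}(A^{(J)})=\sigma^{(J)}$ for all $J\in\mathcal K$,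 where $A^{(J)}$ is the matricization of $A$ whose rows are indexed by the multi-indices $(i_j)_{j\in J}$ and whose columns are indexed by the multi-indices $(i_j)_{j\in\{1,\dots,d\}\setminus J}$, with entries $A(i_1,\dots,i_d)$. *)

(* Defs.v *)
From HB Require Import structures.
From mathcomp Require Import all_boot all_order all_algebra.
From mathcomp Require Import complex reals.

Set Implicit Arguments.
Unset Strict Implicit.
Unset Printing Implicit Defensive.

Import Order.TTheory GRing.Theory Num.Theory.

Local Open Scope ring_scope.
Local Open Scope sesquilinear_scope.
Local Open Scope complex_scope.

Definition Dinf (R : realType) (s : nat -> R) : Prop :=
  [/\ forall k, 0 <= s k, forall k, s k.+1 <= s k &
      exists N, forall k, (N <= k)%N -> s k = 0].

Section Spectra.
Variable R : realType.

(* [closed_field_poly_normal] lists the roots of a polynomial with their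
   multiplicities.  [eig] is only meaningful for matrices with real spectrum,
   since it drops the imaginary parts. *)
Definition eig m (A : 'M[R[i]]_m) : nat -> R :=
  nth 0 (sort >=%R
    (map (@complex.Re R) (sval (closed_field_poly_normal (char_poly A))))).

Definition sv m p (A : 'M[R[i]]_(m, p)) : nat -> R :=
  fun k => Num.sqrt (eig (A ^t* *m A) k).

Definition psdmx m (A : 'M[R[i]]_m) : Prop :=
  A \is hermsymmx /\ forall v : 'rV[R[i]]_m, 0 <= (v *m A *m v ^t*) 0 0.

Lemma eigE m (A : 'M[R[i]]_m) (s : seq R) :
    sorted >=%R s -> char_poly A = \prod_(x <- s) ('X - x%:C%:P) ->
  eig A =1 nth 0 s.
Proof.
move=> s_sorted As k; rewrite /eig; case: closed_field_poly_normal => r /= Ar.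
congr (nth 0 _ k).
have {}Ar : char_poly A = \prod_(z <- r) ('X - z%:P).
  by rewrite Ar (monicP (char_poly_monic A)) scale1r.
have rs : perm_eq r (map (fun x => x%:C) s).
  by apply: prod_XsubC_eq; rewrite -Ar As big_map.
have -> : s = sort >=%R s by rewrite sorted_sort //; exact: ge_trans.
apply/(perm_sortP (@ge_total _ _) (@ge_trans _ _) (@ge_anti _ _)).
have := perm_map (@complex.Re R) rs; rewrite -map_comp.
by rewrite (@eq_map _ _ (_ \o _) id) ?map_id.
Qed.

End Spectra.

Section Tensors.
Variable R : realType.

(* Multi-indices over a finite set [S] of modes, mode [s] having dimension
   [n s].  Matrices with rows or columns indexed by multi-indices are numbered
   through [enum_rank] and [enum_val]. *)
Definition mindex (S : finType) (n : S -> nat) : finType :=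
  {dffun forall s : S, 'I_(n s)}.

Definition kron (S : finType) (n : S -> nat) (A : forall s, 'M[R[i]]_(n s)) :
    'M[R[i]]_#|mindex n| :=
  \matrix_(r, c) \prod_s A s ((enum_val r : mindex n) s)
                             ((enum_val c : mindex n) s).

Variables (T : finType) (n : T -> nat).

Definition dims_on (J : {set T}) (j : {j | j \in J}) : nat := n (val j).
Arguments dims_on : clear implicits.

Definition restr J (x : mindex n) : mindex (dims_on J) :=
  [ffun j => x (val j)].

Definition glue J (r : mindex (dims_on J)) (c : mindex (dims_on (~: J))) :
    mindex n :=
  [ffun i => match decP (@idP (i \in J)) with
             | left iJ => r (exist _ i iJ)
             | right niJ => c (exist _ i (introT setCP niJ))
             end].

(* The linear extension of the defining formula from the basis of elementary
   tensors of unit matrices; [ptrace_kron] recovers it for all elementary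
   tensors. *)
Definition ptrace J (rho : 'M[R[i]]_#|mindex n|) :
    'M[R[i]]_#|mindex (dims_on J)| :=
  \sum_(x : mindex n) \sum_(y : mindex n)
    rho (enum_rank x) (enum_rank y) *:
    (\prod_(i | i \notin J) \tr (delta_mx (x i) (y i) : 'M[R[i]]_(n i)) *:
     kron (fun j : {j | j \in J} =>
             delta_mx (x (val j)) (y (val j)) : 'M_(dims_on J j))).

Definition tensor := mindex n -> R[i].

Definition matricization (A : tensor) J :
    'M[R[i]]_(#|mindex (dims_on J)|, #|mindex (dims_on (~: J))|) :=
  \matrix_(r, c) A (glue (enum_val r) (enum_val c)).

(* A collection indexed by [K] is given as a function on all subsets, of which
   only the values on [K] matter. *)
Definition realizes (K : {set {set T}}) (lambda : {set T} -> nat -> R)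
    (rho : 'M[R[i]]_#|mindex n|) : Prop :=
  psdmx rho /\ forall J, J \in K -> eig (ptrace J rho) =1 lambda J.

Definition compatible K lambda : Prop := exists rho, realizes K lambda rho.

Definition feasible (K : {set {set T}}) (sigma : {set T} -> nat -> R) : Prop :=
  exists A : tensor, forall J, J \in K -> sv (matricization A J) =1 sigma J.

Lemma card_mindex J : #|mindex (dims_on J)| = (\prod_(i in J) n i)%N.
Proof.
rewrite card_dep_ffun foldrE big_map big_enum [RHS]big_sub.
by apply: eq_bigr => j _; rewrite card_ord.
Qed.

Lemma restr_glue J r c : restr J (glue r c) = r.
Proof.
apply/ffunP => -[i iJ]; rewrite !ffunE /=.
case: decP => [iJ'|]; last by [].
by rewrite (bool_irrelevance iJ' iJ).
Qed.

Lemma restrC_glue J (r : mindex (dims_on J)) c : restr (~: J) (glue r c) = c.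
Proof.
apply/ffunP => -[i iJ]; rewrite !ffunE /=.
case: decP => [iJ'|iJ']; first by move/setCP: (iJ).
by rewrite (bool_irrelevance (introT setCP iJ') iJ).
Qed.

Lemma glue_restr J x : glue (restr J x) (restr (~: J) x) = x.
Proof.
by apply/ffunP => i; rewrite ffunE; case: decP => ?; rewrite ffunE.
Qed.

Lemma ptrace_is_linear J : linear (ptrace J).
Proof.
move=> a rho tau; rewrite scaler_sumr -big_split; apply: eq_bigr => x _ /=.
rewrite scaler_sumr -big_split; apply: eq_bigr => y _ /=.
rewrite [X in X *: _ = _]mxE [X in (X + _) *: _]mxE scalerDl.
by congr (_ + _); rewrite [RHS]scalerA.
Qed.

Lemma big_mindex (F : forall i, 'I_(n i) -> R[i]) :
  \prod_i \sum_a F i a = \sum_(x : mindex n) \prod_i F i (x i).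
Proof.
pose G i := [ffun a => F i a].
transitivity (\prod_i \sum_(a : 'I_(n i)) G i a).
  by apply: eq_bigr => i _; apply: eq_bigr => a _; rewrite ffunE.
under eq_bigr => i _ do
  rewrite (big_tag (T_ := fun i => 'I_(n i)) (fun i a => G i a) i).
rewrite bigA_distr_big_dep -(big_fprod 1 _ G).
rewrite (reindex (@fprod_of_dffun T (fun i => 'I_(n i)))); last first.
  exact/onW_bij/fprod_of_dffun_bij.
by apply: eq_bigr => x _; apply: eq_bigr => i _; rewrite fprodE ffunE.
Qed.

Lemma mxtrace_delta m (a b : 'I_m) :
  \tr (delta_mx a b : 'M[R[i]]_m) = (a == b)%:R.
Proof.
rewrite /mxtrace (bigD1 a) //= mxE eqxx big1 ?addr0 // => k ka.
by rewrite mxE (negPf ka).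
Qed.

Lemma ptrace_kron J (A : forall i, 'M[R[i]]_(n i)) :
  ptrace J (kron A) =
  \prod_(i | i \notin J) \tr (A i) *: kron (fun j : {j | j \in J} => A (val j)).
Proof.
apply/matrixP => r c; rewrite summxE.
pose D i (a b : 'I_(n i)) : R[i] := match decP (@idP (i \in J)) with
  | left iJ => delta_mx a b ((enum_val r : mindex (dims_on J)) (exist _ i iJ))
                               ((enum_val c : mindex (dims_on J)) (exist _ i iJ))
  | right _ => \tr (delta_mx a b : 'M[R[i]]_(n i)) end.
pose G i a b := A i a b * D i a b.
transitivity (\sum_(x : mindex n) \sum_(y : mindex n) \prod_i G i (x i) (y i)).
  apply: eq_bigr => x _; rewrite summxE; apply: eq_bigr => y _.
  rewrite !mxE !enum_rankK big_split; congr (_ * _).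
  rewrite [RHS](bigID (fun i => i \in J)) /= mulrC; congr (_ * _).
    rewrite [RHS]big_sub; apply: eq_bigr => -[i iJ] _ /=; rewrite /D.
    by case: decP => [iJ'|]; [rewrite (bool_irrelevance iJ' iJ) | ].
  by apply: eq_bigr => i iJ; rewrite /D; case: decP => // iJ'; rewrite iJ' in iJ.
transitivity (\sum_(x : mindex n) \prod_i \sum_b G i (x i) b).
  by apply: eq_bigr => x _; rewrite -(big_mindex (fun i b => G i (x i) b)).
rewrite -(big_mindex (fun i a => \sum_b G i a b)) (bigID (fun i => i \in J)) /=.
rewrite !mxE mulrC; congr (_ * _).
  apply: eq_bigr => i iJ; rewrite /G /D; case: decP => [iJ'|_].
    by rewrite iJ' in iJ.
  apply: eq_bigr => a _; rewrite (bigD1 a) //= big1 => [|b ba].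
    by rewrite mxtrace_delta eqxx mulr1 addr0.
  by rewrite mxtrace_delta eq_sym (negPf ba) mulr0.
rewrite big_sub; apply: eq_bigr => -[i iJ] _; rewrite /G /D /=.
case: decP => [iJ'|]; last by [].
rewrite (bool_irrelevance iJ' iJ).
set a := fun_of_fin (enum_val r) _; set b := fun_of_fin (enum_val c) _.
rewrite (bigD1 a) //= (bigD1 b) //= !mxE !eqxx mulr1.
rewrite big1 => [|b' b'b].
  rewrite big1 ?addr0 // => a' a'a; apply: big1 => b' _.
  by rewrite !mxE [a == _]eq_sym (negPf a'a) mulr0.
by rewrite !mxE [b == _]eq_sym (negPf b'b) andbF mulr0.
Qed.

End Tensors.

Arguments realizes [R T] n K lambda rho.

Section LastMode.
Variable e : nat.

Definition snoc (n : 'I_e -> nat) (m : nat) (i : 'I_e.+1) : nat :=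
  oapp n m (unlift ord_max i).

Definition incl (J : {set 'I_e}) : {set 'I_e.+1} := lift ord_max @: J.

Definition trunc (J : {set 'I_e.+1}) : {set 'I_e} := lift ord_max @^-1: J.

Lemma inclK : cancel incl trunc.
Proof. by move=> J; apply/setP => i; rewrite inE mem_imset //; apply: lift_inj. Qed.

End LastMode.

(* Main.v *)
Require Import Defs.
From mathcomp Require Import all_boot all_order all_algebra.
From mathcomp Require Import complex reals.

(** A density matrix [rho] on the modes [1, ..., d-1] is positive semi-definite
    exactly when it is a Gram matrix [B *m B^t*], and the least number of
    columns that such a [B] can have is the rank of [rho].  Reading the column
    index of [B] as the index of an extra mode [d] of dimension [n_d] turns [B]
    into a tensor [A] with [d] modes (a purification of [rho]); conversely [B] is
    the flattening of [A] that separates mode [d] from the others.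

    Tracing out the modes outside [J] from [B *m B^t*] sums over exactly the
    multi-indices that label the columns of the matricization [M] of [A] at
    [J]: those of the modes outside [J] together with the index of mode [d].
    Hence the partial trace is [M *m M^t*], up to renaming the multi-indices of
    the modes in [J] as a subset of [d] rather than of [d-1] modes.  As
    [M *m M^t*] and [M^t* *m M] have the same spectrum up to zeros
    ([eig_gramC]), the eigenvalues of the partial trace are the squared singular
    values of [M] ([sv_sqr_eig_ptrace]).

    Both directions follow.  A feasible [A] gives the realizing matrix
    [B *m B^t*]; a realizing [rho] of rank at most [n_d] has a Gram
    factorization with [n_d] columns ([psdmx_factor]), whose tensor has the
    prescribed singular values, these being determined by their squares. *)

Set Implicit Arguments.
Unset Strict Implicit.
Unset Printing Implicit Defensive.

Import Order.TTheory GRing.Theory Num.Theory.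

Local Open Scope ring_scope.
Local Open Scope sesquilinear_scope.
Local Open Scope complex_scope.

(** * Spectra of products and of positive semi-definite matrices *)

(** The block matrix [N] below has two triangularizations by multiplication on
    the right; each computes its determinant, once through [A *m B] and once
    through [B *m A]. *)
Lemma char_poly_mulmxC (R : comNzRingType) m p (A : 'M[R]_(m, p))
    (B : 'M[R]_(p, m)) :
  'X^p * char_poly (A *m B) = 'X^m * char_poly (B *m A).
Proof.
pose a := map_mx polyC A; pose b := map_mx polyC B.
pose N : 'M[{poly R}]_(m + p) := block_mx 'X%:M a b 1%:M.
have hAB : N *m block_mx 1%:M 0 (- b) 'X%:M =
    block_mx (char_poly_mx (A *m B)) ('X *: a) 0 'X%:M.
  rewrite mulmx_block !mulmx1 !mulmx0 add0r mul1mx mul_mx_scalar mulmxN.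
  by rewrite mul1mx add0r subrr /char_poly_mx map_mxM.
have hBA : N *m block_mx 1%:M (- a) 0 'X%:M =
    block_mx 'X%:M 0 b (char_poly_mx (B *m A)).
  rewrite mulmx_block !mulmx1 !mulmx0 !addr0 mul1mx mulmxN mul_scalar_mx.
  rewrite mul_mx_scalar addNr mulmxN addrC.
  by rewrite /char_poly_mx map_mxM.
move/(congr1 determinant): hAB; move/(congr1 determinant): hBA.
rewrite !det_mulmx !(det_ublock, det_lblock) !det1 !mul1r !det_scalar.
by rewrite /char_poly => NBA NAB; rewrite -NBA NAB mulrC.
Qed.

(** The rows and columns of the nonzero diagonal entries, rescaled by their
    inverses, form an identity matrix. *)
Lemma leq_rank_diag_mx (F : fieldType) m (d : 'rV[F]_m) :
  (#|[pred i | d 0%R i != 0%R]| <= \rank (diag_mx d))%N.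
Proof.
pose e : 'I_#|[pred i | d 0 i != 0]| -> 'I_m := enum_val.
pose P := rowsub e 1%:M : 'M[F]_(_, m).
pose Q := \matrix_(i, j) ((d 0 i)^-1 * (i == e j)%:R) : 'M[F]_(m, _).
have PDQ : P *m diag_mx d *m Q = 1%:M.
  rewrite -rowsubE mul_rowsub_mx; apply/matrixP => i j.
  rewrite mxE mul_diag_mx !mxE mulrA mulfV; last exact: (enum_valP i).
  by rewrite mul1r (inj_eq enum_val_inj).
rewrite -[X in (X <= _)%N](mxrank1 F) -PDQ.
exact: leq_trans (mxrankM_maxl _ _) (mxrankM_maxr _ _).
Qed.

Section Psd.
Variable R : realType.
Local Notation C := R[i].

Lemma trmxC_mul m p q (A : 'M[C]_(m, p)) (B : 'M[C]_(p, q)) :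
  (A *m B)^t* = B^t* *m A^t*.
Proof. by rewrite trmx_mul map_mxM. Qed.

Lemma psdmx_gram m p (A : 'M[C]_(m, p)) : psdmx (A *m A^t*).
Proof.
split.
  apply/is_hermitianmxP; rewrite expr0 scale1r.
  by rewrite (trmxC_mul A (A^t*)) trmxCK.
move=> v; rewrite mulmxA -mulmxA -(trmxC_mul v A) mxE.
by apply: sumr_ge0 => k _; rewrite !mxE mul_conjC_ge0.
Qed.

(** The diagonal entries in the spectral theorem are values of the Hermitian
    form of [A] at the rows of [U], hence nonnegative reals. *)
Lemma psdmx_spectral m (A : 'M[C]_m) : psdmx A ->
  exists U : 'M[C]_m, exists x : 'I_m -> R,
    [/\ U *m U^t* = 1%:M, forall i, 0 <= x i &
        A = U^t* *m diag_mx (\row_i (x i)%:C) *m U].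
Proof.
move=> [A_herm A_ge0].
have /orthomx_spectralP := hermitian_normalmx A_herm.
have U_unit := spectral_unitarymx A.
rewrite invmx_unitary //; set U := spectralmx A; set D := spectral_diag A => AE.
have UU : U *m U^t* = 1%:M by apply/unitarymxP.
have D_ge0 i : 0 <= D 0 i.
  have -> : D 0 i = (U *m A *m U^t*) i i.
    by rewrite AE !mulmxA UU mul1mx -mulmxA UU mulmx1 mxE eqxx.
  have := A_ge0 (row i U); rewrite -row_mul !mxE.
  under eq_bigr => k _ do rewrite !mxE.
  by under [in X in _ -> X]eq_bigr => k _ do rewrite !mxE.
have DE : D = \row_i (complex.Re (D 0 i))%:C.
  by apply/rowP => i; rewrite mxE RRe_real // ger0_real.
exists U, (fun i => complex.Re (D 0 i)); split=> [|i|]; first exact: UU.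
  by have := D_ge0 i; rewrite lecE => /andP[].
by rewrite -DE; exact: AE.
Qed.

(** In an orthonormal basis of eigenvectors, only the eigenvectors of nonzero
    eigenvalues contribute a column to a square root of [A], and there are
    [\rank A] of them; the remaining columns of [B] are zero. *)
Lemma psdmx_factor m p (A : 'M[C]_m) : psdmx A -> (\rank A <= p)%N ->
  exists B : 'M[C]_(m, p), A = B *m B^t*.
Proof.
move=> /psdmx_spectral[U [x [UU x_ge0 AE]]] rA.
pose S := enum [pred i | (\row_i (x i)%:C) 0 i != 0].
have S_le : (size S <= p)%N.
  rewrite -cardE; apply: leq_trans (leq_rank_diag_mx _) (leq_trans _ rA).
  have -> : diag_mx (\row_i (x i)%:C) = U *m A *m U^t*.
    by rewrite AE !mulmxA UU mul1mx -mulmxA UU mulmx1.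
  exact: leq_trans (mxrankM_maxl _ _) (mxrankM_maxr _ _).
pose F i j := (U j i)^*%R * (Num.sqrt (x j))%:C.
have FF i l j : F i j * (F l j)^*%R = (U j i)^*%R * (x j)%:C * U j l.
  rewrite /F rmorphM /= conjCK [(_%:C)^*%R]conj_Creal; last first.
    by rewrite ger0_real // lecR sqrtr_ge0.
  rewrite [U j l * _]mulrC !mulrA -(mulrA (_^*%R)) -rmorphM /= -expr2.
  by rewrite sqr_sqrtr.
(* The columns past the size of [S] read the default value 0. *)
pose B : 'M[C]_(m, p) := \matrix_(i, k) nth 0 (map (F i) S) k.
exists B; apply/matrixP => i l; rewrite [in LHS]AE !mxE.
transitivity (\sum_(j <- S) F i j * (F l j)^*%R).
  rewrite big_enum [RHS]big_mkcond; apply: eq_bigr => j _.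
  rewrite FF inE mul_mx_diag !mxE; case: eqP => //= ->.
  by rewrite mulr0 mul0r.
rewrite -(big_map (fun j => F i j * (F l j)^*%R) xpredT id) (big_nth 0).
rewrite size_map big_mkord.
rewrite (big_ord_widen p
  (fun k => nth 0 [seq F i j * (F l j)^*%R | j <- S] k)) //.
rewrite [LHS]big_mkcond; apply: eq_bigr => k _; rewrite !mxE.
case: ltnP => [kS|Sk]; last by rewrite nth_default ?mul0r // size_map.
by rewrite !(nth_map i).
Qed.

Lemma psdmx_char_poly m (A : 'M[C]_m) : psdmx A ->
  exists s : seq R, [/\ sorted >=%R s, all (>= 0) s &
    char_poly A = \prod_(x <- s) ('X - x%:C%:P)].
Proof.
move=> /psdmx_spectral[U [x [UU x_ge0 AE]]].
exists (sort >=%R (codom x)); split.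
    exact/sort_sorted/ge_total.
  by rewrite all_sort; apply/allP => _ /codomP[i ->].
rewrite (perm_big (codom x)) /=; last by rewrite perm_sort.
(* Cancelling ['X^m] turns cyclicity of the product into conjugation invariance. *)
have /mulfI : 'X^m != 0 :> {poly C} by rewrite monic_neq0 ?monicXn.
apply; rewrite AE -mulmxA char_poly_mulmxC -mulmxA UU mulmx1.
rewrite char_poly_trig ?diag_mx_is_trig //; congr (_ * _).
by rewrite big_map big_enum; apply: eq_bigr => i _; rewrite !mxE eqxx.
Qed.

Lemma eig_psdmx_ge0 m (A : 'M[C]_m) k : psdmx A -> 0 <= eig A k.
Proof.
move=> /psdmx_char_poly[s [s_sorted /(all_nthP 0) s_ge0 As]].
rewrite (eigE s_sorted As).
by case: (ltnP k (size s)) => [/s_ge0|/(nth_default 0)->].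
Qed.

(** The two spectra agree after padding with zeros, by [char_poly_mulmxC], and
    [eig] already pads with zeros.  Nonnegativity of the eigenvalues matters:
    it keeps the padded lists sorted. *)
Lemma eig_gramC m p (A : 'M[C]_(m, p)) : eig (A^t* *m A) =1 eig (A *m A^t*).
Proof.
have [s [s_sorted s_ge0 As]] := psdmx_char_poly (psdmx_gram A).
have := psdmx_gram (A^t*); rewrite trmxCK.
move=> /psdmx_char_poly[t [t_sorted t_ge0 At]] k.
rewrite (eigE s_sorted As) (eigE t_sorted At).
have pad q (u : seq R) : sorted >=%R u -> all (>= 0) u ->
    sorted >=%R (u ++ nseq q 0).
  move=> u_sorted u_ge0.
  rewrite sorted_pairwise ?pairwise_cat; last exact: ge_trans.
  rewrite -sorted_pairwise ?u_sorted; last exact: ge_trans.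
  apply/and3P; split=> //; last first.
    by apply/(pairwiseP 0) => i j _ _ _; rewrite !nth_nseq !if_same /=.
  by apply/allrelP => x y /(allP u_ge0) x_ge0 /nseqP[-> _].
have nth_pad q (u : seq R) : nth 0 (u ++ nseq q 0) k = nth 0 u k.
  by rewrite nth_cat nth_nseq if_same; case: ltnP => // /(nth_default 0)->.
have st : perm_eq (t ++ nseq m 0) (s ++ nseq p 0).
  have : perm_eq (map (fun x => x%:C) (t ++ nseq m 0))
                 (map (fun x => x%:C) (s ++ nseq p 0)).
    apply: prod_XsubC_eq; rewrite !big_map !big_cat /= !big_nseq -At -As.
    rewrite polyC0 subr0 !iter_mulr_1 mulrC [RHS]mulrC.
    by rewrite char_poly_mulmxC.
  by move/(perm_map (@complex.Re R)); rewrite -!map_comp !map_id_in.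
rewrite -(nth_pad m t) -(nth_pad p s); congr (nth 0 _ k).
apply: (sorted_eq (leT := >=%R)) => //; try exact: pad.
  exact: ge_trans.
exact: ge_anti.
Qed.

End Psd.

(** * Entries of the partial trace *)

Lemma prodr_natb (R : pzSemiRingType) (I : finType) (P b : pred I) :
  \prod_(i | P i) (b i)%:R = [forall (i | P i), b i]%:R :> R.
Proof.
rewrite -big_andE (big_morph (fun c : bool => c%:R) (id1 := 1) (op1 := *%R)) //.
by move=> c c'; rewrite -natrM mulnb.
Qed.

Section PartialTrace.
Variables (R : realType) (T : finType) (n : T -> nat).
Local Notation C := R[i].

Lemma restrE (J : {set T}) (x : mindex n) j : restr J x j = x (val j).
Proof. exact: ffunE. Qed.

Lemma sum_glue (J : {set T}) (V : nmodType) (F : mindex n -> V) :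
  \sum_x F x = \sum_(r : mindex (dims_on n (J:=J))) \sum_z F (glue r z).
Proof.
rewrite pair_bigA (reindex (fun p : mindex (dims_on n (J:=J)) *
  mindex (dims_on n (J:=~: J)) => glue p.1 p.2)) //=.
exists (fun x => (restr J x, restr (~: J) x)) => [[r z] _|x _] /=.
  by rewrite restr_glue restrC_glue.
by rewrite glue_restr.
Qed.

(** The usual formula for the entries: the row and column multi-indices are
    completed by the same [z] outside [J]. *)
Lemma ptraceE J (rho : 'M[C]_#|mindex n|) r c :
  ptrace J rho r c =
    \sum_z rho (enum_rank (glue (enum_val r) z))
               (enum_rank (glue (enum_val c) z)).
Proof.
have entry (x y : mindex n) :
  (\prod_(i | i \notin J) \tr (delta_mx (x i) (y i) : 'M[C]_(n i)) *:
     kron (fun j : {j | j \in J} =>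
             delta_mx (x (val j)) (y (val j)) : 'M[C]_(dims_on n j))) r c =
   ((restr (~: J) x == restr (~: J) y) && (restr J x == enum_val r)
     && (restr J y == enum_val c))%:R.
  rewrite !mxE.
  under eq_bigr => i _ do rewrite mxtrace_delta.
  under [in X in _ * X]eq_bigr => i _ do rewrite mxE.
  rewrite !prodr_natb -natrM mulnb -andbA; congr (_ && _)%:R.
    apply/forall_inP/eqP => [xy|/ffunP xy i iJ].
      by apply/ffunP => -[i iJ]; rewrite !ffunE; apply/eqP/xy; rewrite -in_setC.
    have := xy (exist _ i (introT setCP (elimN idP iJ))).
    by rewrite !ffunE => /eqP.
  apply/forallP/andP => [xy|[/eqP<- /eqP<-] j]; last by rewrite !ffunE !eqxx.
  by split; apply/eqP/ffunP => j; rewrite ffunE;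
    have /andP[/eqP rx /eqP cy] := xy j.
rewrite summxE; under eq_bigr => x _.
  rewrite summxE; under eq_bigr => y _ do rewrite mxE entry mulr_natr.
  over.
rewrite (sum_glue J) (bigD1 (enum_val r)) //= [X in _ + X]big1 ?addr0
    => [|r' r'r]; last first.
  apply: big1 => z _; apply: big1 => y _.
  by rewrite restr_glue (negPf r'r) andbF.
apply: eq_bigr => z _.
rewrite (sum_glue J) (bigD1 (enum_val c)) //= [X in _ + X]big1 ?addr0
    => [|c' c'c]; last first.
  by apply: big1 => z' _; rewrite !restr_glue (negPf c'c) andbF.
rewrite (bigD1 z) //= big1 ?addr0 => [|z' z'z].
  by rewrite !restr_glue !restrC_glue !eqxx.
by rewrite !restrC_glue eq_sym (negPf z'z).
Qed.

End PartialTrace.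

(** * Multi-indices with an additional last mode *)

Lemma inj_surj_bij (S T : finType) (f : S -> T) :
  injective f -> (forall y, exists x, y = f x) -> bijective f.
Proof.
move=> f_inj f_surj.
have f_surjb y : exists x, f x == y by have [x ->] := f_surj y; exists x.
exists (fun y => xchoose (f_surjb y)) => [x|y].
  exact/f_inj/eqP/(xchooseP (f_surjb (f x))).
exact/eqP/(xchooseP (f_surjb y)).
Qed.

Section Append.
Variables (e : nat) (n : 'I_e -> nat) (m : nat).
Local Notation n' := (snoc n m).

(** The match on [unlift ord_max i] mirrors the definition of [snoc], so that no
    cast between ordinal types is needed here. *)
Definition append (x : mindex n) (k : 'I_m) : mindex n' :=
  [ffun i => match unlift ord_max i as o return 'I_(oapp n m o) with
             | Some j => x j
             | None => k
             end].

Lemma snoc_lift i : snoc n m (lift ord_max i) = n i.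
Proof. by rewrite /snoc liftK. Qed.

Lemma snoc_last : snoc n m ord_max = m.
Proof. by rewrite /snoc unlift_none. Qed.

Definition init_part (y : mindex n') : mindex n :=
  [ffun i => cast_ord (snoc_lift i) (y (lift ord_max i))].

Definition last_part (y : mindex n') : 'I_m := cast_ord snoc_last (y ord_max).

Lemma val_append x k i :
  append x k i = oapp (fun j => val (x j)) (val k) (unlift ord_max i) :> nat.
Proof. by rewrite ffunE /snoc; case: (unlift ord_max i). Qed.

Lemma append_lift x k i : append x k (lift ord_max i) = x i :> nat.
Proof. by rewrite val_append liftK. Qed.

Lemma append_last x k : append x k ord_max = k :> nat.
Proof. by rewrite val_append unlift_none. Qed.

Lemma init_append x k : init_part (append x k) = x.
Proof. by apply/ffunP => i; rewrite ffunE; apply/val_inj; rewrite /= append_lift. Qed.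

Lemma last_append x k : last_part (append x k) = k.
Proof. by apply/val_inj; rewrite /= append_last. Qed.

Lemma append_split y : append (init_part y) (last_part y) = y.
Proof.
apply/ffunP => i; apply/val_inj; case: (unliftP ord_max i) => [j|] ->.
  by rewrite /= append_lift ffunE.
by rewrite /= append_last.
Qed.

Variable J : {set 'I_e}.
Local Notation J' := (incl J).

Lemma mem_incl i : (lift ord_max i \in J') = (i \in J).
Proof. by rewrite mem_imset //; apply: lift_inj. Qed.

Lemma last_notin_incl : ord_max \notin J'.
Proof. by apply/imsetP => -[j _ /eqP]; rewrite (negPf (neq_lift _ _)). Qed.

Lemma restr_append_incl x y k l : restr J x = restr J y ->
  restr J' (append x k) = restr J' (append y l).
Proof.
move=> xy; apply/ffunP => -[i iJ']; rewrite !restrE; apply/val_inj.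
case: (unliftP ord_max i) iJ' => [j|] -> iJ'; last first.
  by move: last_notin_incl; rewrite iJ'.
have iJ : j \in J by rewrite -mem_incl.
by rewrite /= !append_lift; have /ffunP/(_ (exist _ j iJ)) := xy; rewrite !restrE => ->.
Qed.

Lemma restr_append_inclC x y k : restr (~: J) x = restr (~: J) y ->
  restr (~: J') (append x k) = restr (~: J') (append y k).
Proof.
move=> xy; apply/ffunP => -[i iJ']; rewrite !restrE; apply/val_inj.
case: (unliftP ord_max i) iJ' => [j|] -> iJ'; last by rewrite /= !append_last.
have iJ : j \in ~: J by move: iJ'; rewrite !inE mem_incl.
by rewrite /= !append_lift; have /ffunP/(_ (exist _ j iJ)) := xy; rewrite !restrE => ->.
Qed.

(** From here on multi-indices of the modes in [J] (as a subset of the first [e]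
    modes) are matched with those of [incl J], and pairs of a multi-index
    outside [J] and a last index with those outside [incl J].  Either matching
    completes its argument to a multi-index of all modes by the arbitrary [x0]
    and [k0], appends, and restricts. *)
Variables (x0 : mindex n) (k0 : 'I_m).

Definition row_index (r : mindex (dims_on n (J:=J))) :
    mindex (dims_on n' (J:=J')) :=
  restr J' (append (glue r (restr (~: J) x0)) k0).

Definition col_index (p : mindex (dims_on n (J:=~: J)) * 'I_m) :
    mindex (dims_on n' (J:=~: J')) :=
  restr (~: J') (append (glue (restr J x0) p.1) p.2).

(** The two matchings are compatible with gluing; this determines both, and
    yields their bijectivity from that of [glue] and [append]. *)
Lemma glue_index r z k :
  glue (row_index r) (col_index (z, k)) = append (glue r z) k.
Proof.
rewrite -[RHS](glue_restr (incl J)) /row_index /col_index /=; congr (glue _ _).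
  by apply: restr_append_incl; rewrite !restr_glue.
by apply: restr_append_inclC; rewrite !restrC_glue.
Qed.

Lemma append_glue_inj (r r' : mindex (dims_on n (J:=J))) z z' k k' :
  append (glue r z) k = append (glue r' z') k' -> [/\ r = r', z = z' & k = k'].
Proof.
move=> rzk; have := congr1 last_part rzk; rewrite !last_append => ->.
move/(congr1 init_part): rzk; rewrite !init_append => rz; split=> //.
  by rewrite -(restr_glue r z) rz restr_glue.
by rewrite -(restrC_glue r z) rz restrC_glue.
Qed.

Lemma glue_indexP r' c' : exists r p, r' = row_index r /\ c' = col_index p.
Proof.
set y := glue r' c'; exists (restr J (init_part y)).
exists (restr (~: J) (init_part y), last_part y).
set r := restr J _; set p := (_, _).
have yE : glue (row_index r) (col_index p) = y.
  by rewrite glue_index glue_restr append_split.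
split; first by rewrite -(restr_glue r' c') -/y -yE restr_glue.
by rewrite -(restrC_glue r' c') -/y -yE restrC_glue.
Qed.

Lemma row_index_bij : bijective row_index.
Proof.
apply: inj_surj_bij => [r s rs|r'].
  have := glue_index r (restr (~: J) x0) k0.
  by rewrite rs glue_index => /append_glue_inj[].
have [r [p [-> _]]] := glue_indexP r' (col_index (restr (~: J) x0, k0)).
by exists r.
Qed.

Lemma col_index_bij : bijective col_index.
Proof.
apply: inj_surj_bij => [[z k] [z' k'] zk|c'].
  have := glue_index (restr J x0) z k.
  by rewrite zk glue_index => /append_glue_inj[_ -> ->].
by have [r [p [_ ->]]] := glue_indexP (row_index (restr J x0)) c'; exists p.
Qed.

End Append.

(** * Purification *)

Section Purification.
Variables (R : realType) (e : nat) (n : 'I_e -> nat) (m : nat).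
Local Notation C := R[i].

Definition flattening (A : tensor R (snoc n m)) : 'M[C]_(#|mindex n|, m) :=
  \matrix_(i, k) A (append (enum_val i) k).

(** Renaming the rows of [M] by [row_index] changes neither [M^t* *m M] nor, up
    to this renaming, [M *m M^t*]; renaming its columns by [col_index] then
    makes the latter entrywise equal to the partial trace.  The points [x0] and
    [k0] only witness that all dimensions are positive. *)
Lemma sv_sqr_eig_ptrace (x0 : mindex n) (k0 : 'I_m) (A : tensor R (snoc n m))
    (J : {set 'I_e}) k :
  sv (matricization A (incl J)) k ^+ 2 =
  eig (ptrace J (flattening A *m (flattening A)^t*)) k.
Proof.
set M := matricization A (incl J).
pose f (r : 'I_#|mindex (dims_on n (J:=J))|) :=
  enum_rank (row_index x0 k0 (enum_val r)).
pose G := rowsub f M.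
have MM : M^t* *m M = G^t* *m G.
  have f_bij : bijective f.
    have := bij_comp (row_index_bij J x0 k0) (@enum_val_bij _).
    by move/(bij_comp (@enum_rank_bij _)).
  apply/matrixP => c d; rewrite !mxE (reindex f) /=; last exact: onW_bij.
  by apply: eq_bigr => r _; rewrite !mxE.
have GG : ptrace J (flattening A *m (flattening A)^t*) = G *m G^t*.
  apply/matrixP => r s; rewrite ptraceE !mxE.
  under eq_bigr => z _ do rewrite mxE.
  rewrite pair_bigA (reindex (fun p => enum_rank (col_index x0 p))) /=; last first.
    by apply/onW_bij/bij_comp; [exact: enum_rank_bij | exact: col_index_bij J x0 k0].
  apply: eq_bigr => -[z l] _ /=.
  by rewrite !mxE !enum_rankK !glue_index.
have MM_ge0 : 0 <= eig (M^t* *m M) k.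
  by rewrite eig_gramC; apply: eig_psdmx_ge0; apply: psdmx_gram.
by rewrite /sv sqr_sqrtr; [rewrite MM (eig_gramC G) GG | exact: MM_ge0].
Qed.

Lemma flattening_surj B : exists A, flattening A = B.
Proof.
exists (fun y => B (enum_rank (init_part y)) (last_part y)).
by apply/matrixP => i k; rewrite mxE init_append last_append enum_valK.
Qed.

End Purification.

Theorem theorem1p4 (R : realType) (d : nat) (hd : (2 <= d)%N)
    (n : 'I_d.-1 -> nat) (hn : forall i, (0 < n i)%N)
    (K : {set {set 'I_d.-1}}) (hK : set0 \notin K)
    (sigma : {set 'I_d.-1} -> nat -> R)
    (hsigma : forall J, J \in K -> Dinf (sigma J)) :
  (compatible n K (fun J k => sigma J k ^+ 2) <->
   exists nd : nat, (0 < nd)%N /\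
     feasible (snoc n nd) [set incl J | J in K] (fun J => sigma (trunc J)))
  /\
  (forall rho, realizes n K (fun J k => sigma J k ^+ 2) rho ->
   forall nd : nat, (0 < nd)%N -> (\rank rho <= nd)%N ->
     feasible (snoc n nd) [set incl J | J in K] (fun J => sigma (trunc J))).
Proof.
pose x0 : mindex n := [ffun i => Ordinal (hn i)].
have fwd rho (nd : nat) : realizes n K (fun J k => sigma J k ^+ 2) rho ->
    (0 < nd)%N -> (\rank rho <= nd)%N ->
    feasible (snoc n nd) [set incl J | J in K] (fun J => sigma (trunc J)).
  move=> [rho_psd rhoK] nd_gt0 rho_nd.
  have [B rhoE] := psdmx_factor rho_psd rho_nd.
  have [A AB] := flattening_surj B.
  exists A => _ /imsetP[J JK ->] k; rewrite inclK.
  have [sigma_ge0 _ _] := hsigma J JK.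
  apply: (pexpIrn (n := 2)) => //; rewrite ?nnegrE ?sqrtr_ge0 //.
  rewrite (sv_sqr_eig_ptrace x0 (Ordinal nd_gt0)).
  by rewrite AB -rhoE rhoK.
split; last by move=> rho rho_real nd; exact: fwd rho_real.
split=> [[rho rho_real]|[nd [nd_gt0 [A AK]]]].
  (* The zero matrix has rank 0, but the dimension of a mode is positive. *)
  exists (maxn 1 (\rank rho)); split; first by rewrite leq_maxl.
  by apply: fwd rho_real _ _; rewrite ?leq_maxl ?leq_maxr.
exists (flattening A *m (flattening A)^t*); split; first exact: psdmx_gram.
move=> J JK k; rewrite -(sv_sqr_eig_ptrace x0 (Ordinal nd_gt0)).
by rewrite (AK _ (imset_f _ JK)) inclK.
Qed.
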